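(* Let $\varepsilon\in\{1,-1\}$, $\nu,\beta\in\mathbb{N}_0$, $\alpha,k\in\mathbb{N}$, and let $U_{j\alpha}(x)$, $V_{(j-1)\alpha}(x)$ $(j\in\mathbb{N})$ be the polynomials defined by the recurrence relations in the context. Let $B_1,\dots,B_k\in\mathbb{Z}$ and put $$P_{k\alpha}(n;x)=\sum_{j=1}^{k}B_j\big[(n+\nu)^j x^{j\alpha}+U_{j\alpha}(x)\big],\qquad Q_{k\alpha}(x)=\sum_{j=1}^{k}B_j\,V_{(j-1)\alpha}(x).$$ Then for every $x\in\mathbb{Z}$ the series $$\sum_{n=0}^{+\infty}\varepsilon^n\,(n+\nu)!\,P_{k\alpha}(n;x)\,x^{\alpha n+\beta}$$ has the $p$-adic invariant sum $Q_{k\alpha}(x)$; that is, for every prime $p$ the series converges in $\mathbb{Q}_p$ and its sum is $Q_{k\alpha}(x)$.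
   Context: $\mathbb{N}=\{1,2,\dots\}$ and $\mathbb{N}_0=\mathbb{N}\cup\{0\}$. For fixed parameters $\varepsilon,\nu,\alpha,\beta$, the polynomials $U_{k\alpha}(x)$ and $V_{(k-1)\alpha}(x)$ are determined recursively, for $k=1,2,\dots$, by $$\sum_{\ell=1}^{k+1}\binom{k+1}{\ell}x^{(k-\ell+1)\alpha}U_{\ell\alpha}(x)-\varepsilon U_{k\alpha}(x)-x^{(k+1)\alpha}=0,\qquad U_{1\alpha}(x)=x^\alpha-\varepsilon,$$ $$\sum_{\ell=1}^{k+1}\binom{k+1}{\ell}x^{(k-\ell+1)\alpha}V_{(\ell-1)\alpha}(x)-\varepsilon V_{(k-1)\alpha}(x)+\varepsilon\,\nu!\,\nu^k x^{k\alpha+\beta}=0,\qquad V_0(x)=-\varepsilon\,\nu!\,x^\beta.$$ (In each recurrence the $\ell=k+1$ term has coefficient $1$.) ''$p$-adic invariant sum'' means that the sum of the series at an integer $x$ is the same integer in $\mathbb{Q}_p$ for all primes $p$. The convention $x^0=1$ (including $0^0=1$) is used. *)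

(* Defs.v *)
(* mathcomp.classical.boolp provides classical choice and extensionality. *)
From HB Require Import structures.
From mathcomp Require Import all_boot all_order all_algebra.
From mathcomp Require Import boolp ring.
Set Implicit Arguments.
Unset Strict Implicit.
Unset Printing Implicit Defensive.
Import Order.TTheory GRing.Theory Num.Theory.
Local Open Scope ring_scope.

(* Z_p as the inverse limit of the rings Z/p^n: an element is a coherent
   sequence of residues, [res n] being the representative in [0, p^n). *)
Record padic_int (p : nat) (p_pr : prime p) := PadicInt {
  res :> nat -> nat;
  res_coherent : forall n, res n = (res n.+1 %% p ^ n)%N
}.

Section PadicInt.
Variables (p : nat) (p_pr : prime p).
Local Notation Zp := (padic_int p_pr).

HB.instance Definition _ := gen_eqMixin Zp.
HB.instance Definition _ := gen_choiceMixin Zp.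

Lemma padic_intP (u v : Zp) : (forall n, u n = v n) -> u = v.
Proof.
case: u v => [u hu] [v hv] /= uv.
have {}uv : u = v by apply/funext.
by move: hu; rewrite uv => hu; congr PadicInt; apply: Prop_irrelevance.
Qed.

Lemma res_mod (u : Zp) n : (u n %% p ^ n)%N = u n.
Proof. by rewrite {1}res_coherent modn_mod -res_coherent. Qed.

Lemma res_modS (u : Zp) n : u n.+1 = u n %[mod p ^ n].
Proof. by rewrite (res_coherent u n) modn_mod. Qed.

Lemma mk_padic_int_subproof (f : nat -> nat) :
  (forall n, f n.+1 = f n %[mod p ^ n]) ->
  forall n, (f n %% p ^ n = f n.+1 %% p ^ n.+1 %% p ^ n)%N.
Proof. by move=> hf n; rewrite modn_dvdm ?dvdn_exp2l. Qed.

Definition mk_padic_int f hf : Zp := PadicInt p_pr (@mk_padic_int_subproof f hf).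

Fact padic_const_subproof (c : nat) n : c = c %[mod p ^ n]. Proof. by []. Qed.
Definition padic_zero : Zp := mk_padic_int (padic_const_subproof 0).
Definition padic_one : Zp := mk_padic_int (padic_const_subproof 1).

Fact padic_add_subproof (u v : Zp) n :
  (u n.+1 + v n.+1 = u n + v n %[mod p ^ n])%N.
Proof. by rewrite -modnDm !res_modS modnDm. Qed.
Definition padic_add u v : Zp := mk_padic_int (padic_add_subproof u v).

Fact padic_mul_subproof (u v : Zp) n :
  (u n.+1 * v n.+1 = u n * v n %[mod p ^ n])%N.
Proof. by rewrite -modnMm !res_modS modnMm. Qed.
Definition padic_mul u v : Zp := mk_padic_int (padic_mul_subproof u v).

Lemma res_lt (u : Zp) n : (u n < p ^ n)%N.
Proof. by rewrite -res_mod ltn_mod expn_gt0 prime_gt0. Qed.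

Fact padic_opp_subproof (u : Zp) n :
  (p ^ n.+1 - u n.+1 = p ^ n - u n %[mod p ^ n])%N.
Proof.
apply/eqP; rewrite -(eqn_modDr (u n.+1)) subnK 1?ltnW ?res_lt //.
rewrite -modnDmr res_modS modnDmr subnK 1?ltnW ?res_lt //.
by rewrite modnn expnS modnMl.
Qed.
Definition padic_opp u : Zp := mk_padic_int (padic_opp_subproof u).

Fact padic_addA : associative padic_add.
Proof. by move=> u v w; apply: padic_intP => n /=; rewrite modnDmr modnDml addnA. Qed.
Fact padic_addC : commutative padic_add.
Proof. by move=> u v; apply: padic_intP => n /=; rewrite addnC. Qed.
Fact padic_add0 : left_id padic_zero padic_add.
Proof. by move=> u; apply: padic_intP => n /=; rewrite modnDml add0n res_mod. Qed.
Fact padic_addN : left_inverse padic_zero padic_opp padic_add.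
Proof.
move=> u; apply: padic_intP => n /=.
by rewrite modnDml subnK 1?ltnW ?res_lt // modnn mod0n.
Qed.
HB.instance Definition _ := GRing.isZmodule.Build Zp
  padic_addA padic_addC padic_add0 padic_addN.

Fact padic_mulA : associative padic_mul.
Proof. by move=> u v w; apply: padic_intP => n /=; rewrite modnMmr modnMml mulnA. Qed.
Fact padic_mulC : commutative padic_mul.
Proof. by move=> u v; apply: padic_intP => n /=; rewrite mulnC. Qed.
Fact padic_mul1 : left_id padic_one padic_mul.
Proof. by move=> u; apply: padic_intP => n /=; rewrite modnMml mul1n res_mod. Qed.
Fact padic_mulD : left_distributive padic_mul +%R.
Proof.
by move=> u v w; apply: padic_intP => n /=; rewrite modnMml modnDm mulnDl.
Qed.
Fact padic_one_neq0 : padic_one != 0 :> Zp.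
Proof.
apply/eqP => /(congr1 (fun u : Zp => u 1%N)) /=.
by rewrite mod0n modn_small // expn1 prime_gt1.
Qed.
HB.instance Definition _ := GRing.Zmodule_isComNzRing.Build Zp
  padic_mulA padic_mulC padic_mul1 padic_mulD padic_one_neq0.

Definition padic_unit : pred Zp := fun u => `[< exists v, v * u = 1 >].
Definition padic_inv (u : Zp) : Zp :=
  if pselect (exists v, v * u = 1) is left h then sval (cid h) else u.

Fact padic_mulV : {in padic_unit, left_inverse 1 padic_inv *%R}.
Proof.
move=> u /asboolP hu; rewrite /padic_inv.
by case: pselect => // h; case: cid.
Qed.
Fact padic_unitP (u v : Zp) : v * u = 1 -> padic_unit u.
Proof. by move=> uv; apply/asboolP; exists v. Qed.
Fact padic_inv_out : {in [predC padic_unit], padic_inv =1 id}.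
Proof.
move=> u /negP hu; rewrite /padic_inv.
by case: pselect => // h; case: hu; apply/asboolP.
Qed.
HB.instance Definition _ := GRing.ComNzRing_hasMulInverse.Build Zp
  padic_mulV padic_unitP padic_inv_out.

Lemma res_modD (u : Zp) m n : u (m + n)%N = u m %[mod p ^ m].
Proof.
elim: n => [|n IHn]; first by rewrite addn0.
rewrite addnS -IHn -(modn_dvdm (u (m + n).+1) (dvdn_exp2l p (leq_addr n m))).
by rewrite res_modS modn_dvdm // dvdn_exp2l // leq_addr.
Qed.

Lemma padic_neq0 (u : Zp) : u != 0 -> exists m, u m != 0%N.
Proof.
move=> u0; apply/not_existsP => h; case/eqP: u0.
by apply: padic_intP => n; rewrite /= mod0n; apply/eqP; apply: contra_notT (h n).
Qed.

Lemma dvdn_res (u : Zp) m n : (p ^ m %| u (m + n)%N)%N = (u m == 0%N).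
Proof. by rewrite /dvdn res_modD res_mod. Qed.

Fact padic_int_integral : GRing.integral_domain_axiom Zp.
Proof.
move=> u v uv0; have [//|/padic_neq0[m um] /=] := eqVneq u 0.
have [//|/padic_neq0[n vn]] := eqVneq v 0.
have : (p ^ (m + n) %| u (m + n) * v (m + n))%N.
  by apply/eqP; have /(congr1 (fun w : Zp => w (m + n)%N)) /= := uv0; rewrite mod0n.
move: um vn; rewrite -(dvdn_res u m n) -(dvdn_res v n m) (addnC n m).
move: (u _) (v _) => a b pa pb.
have a0 : (0 < a)%N by case: a pa; rewrite ?dvdn0.
have b0 : (0 < b)%N by case: b pb; rewrite ?dvdn0.
move: pa pb; rewrite !pfactor_dvdn ?muln_gt0 ?a0 // lognM // -!ltnNge => am bn.
by rewrite leqNgt -addnS leq_add // ltnW.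
Qed.
HB.instance Definition _ :=
  GRing.ComUnitRing_isIntegral.Build Zp padic_int_integral.

Lemma res_natr c n : (c%:R : Zp) n = (c %% p ^ n)%N.
Proof.
elim: c => [//|c IHc]; rewrite mulrS /= IHc.
by rewrite modnDmr modnDml add1n.
Qed.

End PadicInt.

Definition padic_num (p : nat) (p_pr : prime p) := {fraction (padic_int p_pr)}.
HB.instance Definition _ p p_pr := GRing.Field.on (@padic_num p p_pr).

(* With padic_num = Q_p, this is p^m Z_p = { y in Q_p : |y|_p <= p^-m }. *)
Definition padic_small p (p_pr : prime p) (m : nat) (y : padic_num p_pr) : Prop :=
  exists z : padic_int p_pr, y = p%:R ^+ m * FracField.tofrac z.

Definition padic_cvg p (p_pr : prime p) (u : nat -> padic_num p_pr)
    (l : padic_num p_pr) : Prop :=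
  forall m, exists N, forall n, (N <= n)%N -> padic_small m (u n - l).

Definition padic_series_sum p (p_pr : prime p) (a : nat -> padic_num p_pr)
    (s : padic_num p_pr) : Prop :=
  padic_cvg (fun N => \sum_(0 <= n < N) a n) s.

Definition padic_invariant_sum (a : nat -> int) (s : int) : Prop :=
  forall p (p_pr : prime p),
    @padic_series_sum p p_pr (fun n => (a n)%:~R) s%:~R.

Lemma fraction_numden (R : idomainType) (y : {fraction R}) :
  exists a b, b != 0 /\ y * FracField.tofrac b = FracField.tofrac a.
Proof.
rewrite -[y]reprK; case: (repr y) => -[a b] /= b0; exists a, b; split=> //.
unlock FracField.tofrac; rewrite -[LHS]FracField.pi_mul.
apply/eqmodP; rewrite /= FracField.equivfE /FracField.mulf /=.
by rewrite !numden_Ratio ?oner_eq0 ?mulr1 // mulrC.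
Qed.

Lemma padic_small_eq0 p (p_pr : prime p) (y : padic_num p_pr) :
  (forall m, padic_small m y) -> y = 0.
Proof.
move=> small_y; have [a [b [b0 yE]]] := fraction_numden y.
suff a0 : a = 0.
  have bF0 : FracField.tofrac b != 0 by rewrite tofrac_eq0.
  by apply: (mulIf bF0); rewrite yE a0 mul0r tofrac0.
apply: padic_intP => n; have [z zE] := small_y n.
have pE : p%:R ^+ n = FracField.tofrac (p ^ n)%:R :> padic_num p_pr.
  by rewrite rmorph_nat natrX.
move/eqP: yE; rewrite zE pE -!tofracM tofrac_eq => /eqP <-.
by rewrite /= res_natr modnn mul0n !mod0n.
Qed.

Lemma padic_cvg_unique p (p_pr : prime p) (u : nat -> padic_num p_pr) l l' :
  padic_cvg u l -> padic_cvg u l' -> l = l'.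
Proof.
move=> ul ul'; apply/eqP; rewrite -subr_eq0; apply/eqP/padic_small_eq0 => m.
have [[N hN] [N' hN']] := (ul m, ul' m).
have [z zE] := hN _ (leq_maxl N N'); have [z' zE'] := hN' _ (leq_maxr N N').
by exists (z' - z); rewrite tofracB mulrBr -zE -zE'; ring.
Qed.

(* The family (U_{j alpha}), j >= 1, is given by its recurrence: [U j] stands
   for U_{j alpha}, and [U 0] is irrelevant. The term l = k+1 has coefficient 1,
   so the equation for k determines [U k.+1]. *)
Definition U_spec (eps : int) (alpha : nat) (U : nat -> {poly int}) : Prop :=
  U 1%N = 'X^alpha - eps%:P /\
  forall k : nat, (0 < k)%N ->
    \sum_(1 <= l < k.+2) ('X^((k.+1 - l) * alpha) * U l) *+ 'C(k.+1, l)
      - eps%:P * U k - 'X^(k.+1 * alpha) = 0.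

(* Likewise, [V j] stands for V_{j alpha}, j >= 0. *)
Definition V_spec (eps : int) (nu alpha beta : nat) (V : nat -> {poly int}) :
    Prop :=
  V 0%N = - (eps * (nu`!)%:Z)%:P * 'X^beta /\
  forall k : nat, (0 < k)%N ->
    \sum_(1 <= l < k.+2) ('X^((k.+1 - l) * alpha) * V l.-1) *+ 'C(k.+1, l)
      - eps%:P * V k.-1
      + (eps * (nu`!)%:Z * nu%:Z ^+ k)%:P * 'X^(k * alpha + beta) = 0.

Definition P_val (nu alpha k : nat) (B : nat -> int) (U : nat -> {poly int})
    (n : nat) (x : int) : int :=
  \sum_(1 <= j < k.+1) B j * ((n + nu)%:Z ^+ j * x ^+ (j * alpha) + (U j).[x]).

Definition Q_val (k : nat) (B : nat -> int) (V : nat -> {poly int}) (x : int) :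
    int :=
  \sum_(1 <= j < k.+1) B j * (V j.-1).[x].

Lemma course_of_values (T : Type) (F : nat -> (nat -> T) -> T) :
  (forall n f g, (forall m, (m < n)%N -> f m = g m) -> F n f = F n g) ->
  (exists x : T, True) -> exists f, forall n, f n = F n f.
Proof.
move=> hF [x0 _].
pose g := fix g n := if n is n'.+1 then
   fun m => if m == n' then F n' (g n') else g n' m else fun _ => x0.
have gE n m : (m < n)%N -> g n m = F m (g m).
  elim: n => // n IHn; rewrite ltnS leq_eqVlt /=.
  by case: eqP => [->|_ /= /IHn].
exists (fun n => g n.+1 n) => n; rewrite (gE n.+1) //.
by apply: hF => m mn; rewrite !gE.
Qed.

Lemma U_spec_exists eps alpha : exists U, U_spec eps alpha U.
Proof.
have [|//|U hU] := @course_of_values {poly int} (fun n U =>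
  if n is k.+1 then if k is 0 then 'X^alpha - eps%:P else
    'X^(k.+1 * alpha) + eps%:P * U k -
    \sum_(1 <= l < k.+1) ('X^((k.+1 - l) * alpha) * U l) *+ 'C(k.+1, l)
  else 0).
- case=> [//|[//|k]] f g fg; rewrite fg //; congr (_ - _).
  by apply: eq_big_nat => l /andP[_ lk]; rewrite fg.
- by exists 0.
exists U; split=> [|k k0]; first by rewrite hU.
rewrite big_nat_recr //= (hU k.+1) subnn mul0n expr0 mul1r binn mulr1n.
case: k k0 => // k _; ring.
Qed.

Lemma V_spec_exists eps nu alpha beta : exists V, V_spec eps nu alpha beta V.
Proof.
have [|//|V hV] := @course_of_values {poly int} (fun n V =>
  if n is k.+1 then
    eps%:P * V k - (eps * (nu`!)%:Z * nu%:Z ^+ k.+1)%:P * 'X^(k.+1 * alpha + beta)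
    - \sum_(1 <= l < k.+2) ('X^((k.+2 - l) * alpha) * V l.-1) *+ 'C(k.+2, l)
  else - (eps * (nu`!)%:Z)%:P * 'X^beta).
- case=> [//|k] f g fg; rewrite fg //; congr (_ - _).
  by apply: eq_big_nat => -[//|l] /andP[_ lk]; rewrite fg.
- by exists 0.
exists V; split=> [|[//|k] _]; first by rewrite hV.
rewrite big_nat_recr //= (hV k.+1) subnn mul0n expr0 mul1r binn mulr1n; ring.
Qed.

(* Main.v *)
Require Import Defs.
From mathcomp Require Import all_boot all_order all_algebra.
From mathcomp Require Import ring.
Set Implicit Arguments.
Unset Strict Implicit.
Unset Printing Implicit Defensive.
Import GRing.Theory.
Local Open Scope ring_scope.

(** With [y = x ^ alpha], put [T n = eps ^ n * (n + nu)! * y ^ n * x ^ beta].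
    Since [eps ^ 2 = 1], [eps * T n.+1 = T n * (n + nu + 1) * y], so that
    the difference between [n.+1] and [n] of
    [eps * T n * (n + nu) ^ k * y ^ k] is
    [T n * ((n + nu + 1) ^ k.+1 * y ^ k.+1 - eps * (n + nu) ^ k * y ^ k)], and
    the sum of the latter telescopes.  Expanding the binomial expresses it as a
    combination of the terms [T n * ((n + nu) ^ l * y ^ l + U l)], [l <= k.+1];
    the recurrence for [U] says exactly that the constants [U l] introduced in
    this way cancel ([binomial_shift]).

    Summing over [n < N], the partial sums of the [l]-th series satisfy the
    recurrence of [V] up to the boundary term at [N], the boundary term at [0]
    accounting for the inhomogeneous term of that recurrence.  The errors,
    partial sum minus [V l.-1], thus satisfy a linear recurrence whose inhomogeneous term
    is a multiple of [(N + nu)!], and the coefficient of the newest error is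
    [1]; so all of them are divisible by [(N + nu)!] as integers
    ([partial_sum_moment_dvd]).  A linear combination of the errors remains
    divisible, and factorials tend to [0] in every [Z_p]
    ([padic_invariant_sum_fact_dvd]). *)

(** A power [p ^ m] divides [N!] as soon as [p ^ m <= N], so this divisibility
    forces convergence for all primes at once. *)
Lemma padic_invariant_sum_fact_dvd (a : nat -> int) (s : int) :
  (forall N, ((N`!)%:Z %| \sum_(0 <= n < N) a n - s)%Z) ->
  padic_invariant_sum a s.
Proof.
move=> a_dvd p p_pr m; exists (p ^ m)%N => N leN.
have : ((p ^ m)%:Z %| \sum_(0 <= n < N) a n - s)%Z.
  apply: dvdz_trans (a_dvd N).
  by rewrite dvdzE /= dvdn_fact // expn_gt0 prime_gt0.
case/dvdzP=> q sum_q; exists q%:~R.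
rewrite -raddf_sum -rmorphB /= sum_q rmorphM /= mulrC.
by rewrite -pmulrn natrX rmorph_int.
Qed.

Section FactorialMoments.

Variables (eps y c : int) (nu : nat).
Hypothesis eps_sq : eps * eps = 1.

(** This is [T n], with [c] for [x ^ beta]: the recurrences involve [x] only
    through [y = x ^ alpha] and [c]. *)
Definition fact_weight (n : nat) : int :=
  eps ^+ n * ((n + nu)`!)%:Z * y ^+ n * c.

Lemma fact_weightS n :
  fact_weight n * ((n + nu).+1%:Z * y) = eps * fact_weight n.+1.
Proof.
rewrite /fact_weight addSn factS PoszM !exprS.
by rewrite -[in LHS](mul1r (eps ^+ n)) -eps_sq; ring.
Qed.

Lemma sum_fact_weight_telescope k N :
  \sum_(0 <= n < N) fact_weight n *
     ((n + nu).+1%:Z ^+ k.+1 * y ^+ k.+1 - eps * ((n + nu)%:Z ^+ k * y ^+ k)) =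
  eps * (fact_weight N * ((N + nu)%:Z ^+ k * y ^+ k) -
         fact_weight 0 * (nu%:Z ^+ k * y ^+ k)).
Proof.
pose F n := fact_weight n * ((n + nu)%:Z ^+ k * y ^+ k).
rewrite -[X in _ = eps * X]/(F N - F 0%N) -telescope_sumr // mulr_sumr.
apply: eq_bigr => n _; rewrite /F addSn [RHS]mulrBr.
rewrite [X in _ = X - _]mulrA -fact_weightS.
by rewrite !exprS; ring.
Qed.

Variables u v : nat -> int.
Hypothesis u1 : u 1%N = y - eps.
Hypothesis u_rec : forall k, (0 < k)%N ->
  \sum_(1 <= l < k.+2) (y ^+ (k.+1 - l) * u l) *+ 'C(k.+1, l)
    - eps * u k - y ^+ k.+1 = 0.
Hypothesis v0 : v 0%N = - (eps * (nu`!)%:Z * c).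
Hypothesis v_rec : forall k, (0 < k)%N ->
  \sum_(1 <= l < k.+2) (y ^+ (k.+1 - l) * v l.-1) *+ 'C(k.+1, l)
    - eps * v k.-1 + eps * (nu`!)%:Z * nu%:Z ^+ k * (y ^+ k * c) = 0.

Definition moment (l m : nat) : int := m%:Z ^+ l * y ^+ l + u l.

(** The [l = 0] term of the binomial expansion is [y ^ k.+1], which is the
    inhomogeneous term of the recurrence for [u]. *)
Lemma binomial_shift k m : (0 < k)%N ->
  m.+1%:Z ^+ k.+1 * y ^+ k.+1 - eps * (m%:Z ^+ k * y ^+ k) =
  \sum_(1 <= l < k.+2) (y ^+ (k.+1 - l) * moment l m) *+ 'C(k.+1, l)
    - eps * moment k m.
Proof.
move=> k0.
have -> : m.+1%:Z ^+ k.+1 * y ^+ k.+1 = y ^+ k.+1 +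
    \sum_(1 <= l < k.+2)
       (y ^+ (k.+1 - l) * (m%:Z ^+ l * y ^+ l)) *+ 'C(k.+1, l).
  rewrite -exprMn intS mulrDl mul1r exprDn.
  rewrite -(big_mkord xpredT
    (fun l => (y ^+ (k.+1 - l) * (m%:Z * y) ^+ l) *+ 'C(k.+1, l))).
  rewrite big_ltn // subn0 expr0 mulr1 bin0 mulr1n.
  by congr (_ + _); apply: eq_bigr => l _; rewrite exprMn.
under [in RHS]eq_bigr do rewrite mulrDr mulrnDl.
by rewrite big_split /= /moment; have /eqP := u_rec k0;
  rewrite subr_eq0 => /eqP <-; ring.
Qed.

Definition partial_sum_moment (l N : nat) : int :=
  \sum_(0 <= n < N) fact_weight n * moment l (n + nu).

Lemma fact_weight_dvd N : (((N + nu)`!)%:Z %| fact_weight N)%Z.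
Proof. by rewrite /fact_weight -!mulrA dvdz_mull // dvdz_mulr. Qed.

Lemma partial_sum_moment1 N :
  partial_sum_moment 1 N - v 0 = eps * fact_weight N.
Proof.
have := sum_fact_weight_telescope 0 N.
rewrite !expr0 !mulr1 => tel; rewrite /partial_sum_moment v0.
under eq_bigr => n _.
  rewrite (_ : moment 1 (n + nu) = (n + nu).+1%:Z ^+ 1 * y ^+ 1
             - eps * ((n + nu)%:Z ^+ 0 * y ^+ 0)); last first.
    by rewrite /moment u1 intS; ring.
  over.
by under eq_bigr do rewrite !expr0 !mulr1; rewrite tel /fact_weight; ring.
Qed.

(** The boundary term at [n = 0] of the telescoping sum is cancelled by the
    inhomogeneous term of the recurrence for [v]; this is why [v] gives the
    sums of the series. *)
Lemma partial_sum_moment_rec k N : (0 < k)%N ->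
  \sum_(1 <= l < k.+2)
     (y ^+ (k.+1 - l) * (partial_sum_moment l N - v l.-1)) *+ 'C(k.+1, l)
    - eps * (partial_sum_moment k N - v k.-1) =
  eps * (fact_weight N * ((N + nu)%:Z ^+ k * y ^+ k)).
Proof.
move=> k0.
have tel := sum_fact_weight_telescope k N.
have sumE : \sum_(1 <= l < k.+2)
     (y ^+ (k.+1 - l) * partial_sum_moment l N) *+ 'C(k.+1, l)
    - eps * partial_sum_moment k N =
  eps * (fact_weight N * ((N + nu)%:Z ^+ k * y ^+ k) -
         fact_weight 0 * (nu%:Z ^+ k * y ^+ k)).
  rewrite -tel; under [in RHS]eq_bigr do rewrite binomial_shift // mulrBr.
  rewrite sumrB; congr (_ - _); last first.
    by rewrite mulr_sumr; apply: eq_bigr => n _; rewrite mulrCA.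
  under [in RHS]eq_bigr do rewrite mulr_sumr.
  rewrite exchange_big /=; apply: eq_bigr => l _.
  rewrite mulr_sumr -sumrMnl; apply: eq_bigr => n _.
  by rewrite mulrnAr mulrCA.
under eq_bigr do rewrite mulrBr mulrnBl.
rewrite sumrB; have := v_rec k0; move: sumE.
set A := \sum_(_ <= _ < _) _; set A' := \sum_(_ <= _ < _) _.
rewrite /fact_weight => sumE vE.
transitivity ((A - eps * partial_sum_moment k N) - (A' - eps * v k.-1)).
  by ring.
move/eqP: vE; rewrite addr_eq0 => /eqP ->; rewrite sumE add0n !expr0; ring.
Qed.

(** In the recurrence for the errors the newest one has coefficient [1], so
    divisibility propagates by strong induction. *)
Lemma partial_sum_moment_dvd l N :
  (((N + nu)`!)%:Z %| partial_sum_moment l.+1 N - v l)%Z.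
Proof.
elim/ltn_ind: l => -[_|l IH].
  by rewrite partial_sum_moment1 dvdz_mull // fact_weight_dvd.
have := partial_sum_moment_rec N (ltn0Sn l).
rewrite big_nat_recr //= subnn expr0 mul1r binn mulr1n.
set A := \sum_(_ <= _ < _) _ => recE.
have -> : partial_sum_moment l.+2 N - v l.+1 =
    eps * (fact_weight N * ((N + nu)%:Z ^+ l.+1 * y ^+ l.+1))
    + eps * (partial_sum_moment l.+1 N - v l) - A by rewrite -recE; ring.
rewrite rpredB ?rpredD //.
- by rewrite dvdz_mull // dvdz_mulr // fact_weight_dvd.
- by rewrite dvdz_mull // IH.
rewrite /A big_nat; apply: rpred_sum => -[//|i] /andP[_ il].
by rewrite rpredMn // dvdz_mull // IH.
Qed.

End FactorialMoments.

Theorem theorem3p3 (eps : int) (nu beta alpha k : nat)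
    (U V : nat -> {poly int}) (B : nat -> int)
    (eps_pm1 : eps = 1 \/ eps = -1) (alpha_gt0 : (0 < alpha)%N)
    (k_gt0 : (0 < k)%N)
    (U_rec : U_spec eps alpha U) (V_rec : V_spec eps nu alpha beta V) (x : int) :
  padic_invariant_sum
    (fun n : nat => eps ^+ n * ((n + nu)`!)%:Z * P_val nu alpha k B U n x
                    * x ^+ (alpha * n + beta))
    (Q_val k B V x).
Proof.
have eps_sq : eps * eps = 1 by case: eps_pm1 => ->.
pose y := x ^+ alpha; pose c := x ^+ beta.
pose u j := (U j).[x]; pose v j := (V j).[x].
have yE i : x ^+ (i * alpha) = y ^+ i by rewrite mulnC exprM.
have u1 : u 1%N = y - eps by rewrite /u U_rec.1 !hornerE.
have u_rec i : (0 < i)%N ->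
    \sum_(1 <= l < i.+2) (y ^+ (i.+1 - l) * u l) *+ 'C(i.+1, l)
      - eps * u i - y ^+ i.+1 = 0.
  move=> /(U_rec.2 i) /(congr1 (horner^~ x)).
  rewrite !hornerE horner_sum yE => eq0; rewrite -[RHS]eq0; congr (_ - _ - _).
  by apply: eq_bigr => l _; rewrite hornerMn !hornerE yE.
have v0 : v 0%N = - (eps * (nu`!)%:Z * c).
  by rewrite /v V_rec.1 !hornerE mulNr.
have v_rec i : (0 < i)%N ->
    \sum_(1 <= l < i.+2) (y ^+ (i.+1 - l) * v l.-1) *+ 'C(i.+1, l)
      - eps * v i.-1 + eps * (nu`!)%:Z * nu%:Z ^+ i * (y ^+ i * c) = 0.
  move=> /(V_rec.2 i) /(congr1 (horner^~ x)).
  rewrite !hornerE horner_sum exprD yE => eq0.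
  rewrite -[RHS]eq0; congr (_ - _ + _); last by rewrite mulrA.
  by apply: eq_bigr => l _; rewrite hornerMn !hornerE yE.
apply: padic_invariant_sum_fact_dvd => N.
have -> : \sum_(0 <= n < N) eps ^+ n * ((n + nu)`!)%:Z
            * P_val nu alpha k B U n x * x ^+ (alpha * n + beta)
          - Q_val k B V x =
    \sum_(1 <= j < k.+1)
       B j * (partial_sum_moment eps y c nu u j N - v j.-1).
  under [in RHS]eq_bigr do rewrite mulrBr.
  rewrite sumrB; congr (_ - _).
  under [in RHS]eq_bigr do rewrite mulr_sumr.
  rewrite exchange_big /=; apply: eq_bigr => n _.
  rewrite /P_val mulr_sumr mulr_suml; apply: eq_bigr => j _.
  by rewrite /fact_weight /moment yE exprD exprM -/y -/c -/(u j); ring.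
rewrite big_nat; apply: rpred_sum => -[//|j] _; rewrite dvdz_mull //.
apply: dvdz_trans (partial_sum_moment_dvd eps_sq u1 u_rec v0 v_rec j N).
by rewrite dvdzE /= -(ffact_fact (leq_addl N nu)) addnK dvdn_mull.
Qed.
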